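(* Let $d\ge1$, let $u$ be an $\mathcal{H}$-harmonic function of a positive Schrödinger operator $\mathcal{H}=\Delta+V$ on $\mathbb{Z}^d$ with $V\le1$, and let $\lambda=\cosh^{-1}(3/2)=0.962\ldots<1$. If (a) $u$ is bounded in case $d=1,2$, (b) $u\in O\big(|x|^{(2-d)/2}\big)$ in case $d\ge3$, and for some element $e_j$, $j\in\{1,\dots,d\}$, of the standard basis of $\mathbb{Z}^d$ $$\liminf_{n\to\infty}|u(ne_j)|\,n^{(d-1)/2}\,\mathrm{e}^{\lambda n}=0,$$ then $u=0$.
   Context: On $\mathbb{Z}^d$, $|x|=(|x_1|^2+\dots+|x_d|^2)^{1/2}$ is the Euclidean norm, and the Laplacian (standard weights $b(x,y)=1$ if $|x-y|=1$ and $0$ otherwise, measure $m=1$) is $\Delta f(x)=\sum_{|y-x|=1}(f(x)-f(y))$ for $f:\mathbb{Z}^d\to\mathbb{R}$. For a potential $V:\mathbb{Z}^d\to\mathbb{R}$, $\mathcal{H}f=\Delta f+Vf$. A function $u:\mathbb{Z}^d\to\mathbb{R}$ is $\mathcal{H}$-harmonic if $\mathcal{H}u=0$ on $\mathbb{Z}^d$. $\mathcal{H}$ is positive if there exists a nontrivial function $w\ge0$ on $\mathbb{Z}^d$ with $\mathcal{H}w\ge0$; equivalently, $\frac12\sum_{|x-y|=1}(\varphi(x)-\varphi(y))^2+\sum_xV(x)\varphi(x)^2\ge0$ (first sum over ordered pairs) for all finitely supported $\varphi$. $f\in O(g)$ means $\limsup_{x\to\infty}|f(x)|/|g(x)|<\infty$,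 where $x\to\infty$ means that $x$ leaves every finite set. $\cosh^{-1}$ denotes the (nonnegative) inverse hyperbolic cosine. *)

(* Defs.v *)
From HB Require Import structures.
From mathcomp Require Import all_boot all_order all_algebra.
From mathcomp Require Import all_classical all_reals all_analysis.
From mathcomp Require Import ring lra zify.

Set Implicit Arguments.
Unset Strict Implicit.
Unset Printing Implicit Defensive.

Import Order.TTheory GRing.Theory Num.Def Num.Theory.
Import numFieldNormedType.Exports.

Local Open Scope classical_set_scope.
Local Open Scope ring_scope.

Section Schroedinger.
Variables (R : realType) (d : nat).
Implicit Types (f u V : 'rV[int]_d -> R) (x y : 'rV[int]_d).

Definition enorm x : R := Num.sqrt (\sum_(i < d) ((x 0 i)%:~R : R) ^+ 2).

(* [\sum_(y \in A) F y] is 0 by convention when [F] has infinitely many nonzero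
   values on [A]; see [finite_nbrs]. *)
Definition laplacian f x : R := \sum_(y \in [set y | enorm (y - x) = 1]) (f x - f y).

Definition schroedinger V f x : R := laplacian f x + V x * f x.

Definition H_harmonic V u := forall x, schroedinger V u x = 0.

Definition positive_schroedinger V :=
  exists w : 'rV[int]_d -> R, [/\ exists x, w x != 0, forall x, 0 <= w x
    & forall x, 0 <= schroedinger V w x].

(* The limit superior is along the cofinite filter, so the points where [g]
   vanishes (and [_ / 0 = 0]) do not matter as long as they are finitely many.
   [principal_filter_type T] is [T]; it only provides the [filteredType]
   structure that [limf_esup] asks for and never uses. *)
Definition inO f (g : 'rV[int]_d -> R) :=
  (limf_esup (X := principal_filter_type 'rV[int]_d)
     (fun x => (`|f x| / `|g x|)%:E) (@frechet_filter 'rV[int]_d) < +oo)%E.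

Lemma enorm1_le x i : enorm x = 1 -> (`|x 0%R i| <= 1)%N.
Proof.
move=> /(congr1 (fun t => t ^+ 2)).
rewrite /enorm sqr_sqrtr ?expr1n; last by apply: sumr_ge0 => j _; apply: sqr_ge0.
rewrite (bigD1 i) //= => e1.
have : ((x 0 i)%:~R : R) ^+ 2 <= 1.
  by rewrite -[leRHS]e1 lerDl; apply: sumr_ge0 => j _; apply: sqr_ge0.
by rewrite -rmorphXn /= -[1]/(1%:~R) ler_int; move: (x 0 i) => [[|[|n]]|[|n]].
Qed.

Lemma finite_nbrs x : finite_set [set y | enorm (y - x) = 1].
Proof.
pose F (g : {ffun 'I_d -> 'I_3}) : 'rV[int]_d := \row_i ((g i)%:Z - 1 + x 0 i).
apply: (@sub_finite_set _ _ (F @` setT)); last exact/finite_image/finite_finset.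
move=> y /= y1.
exists [ffun i => inord `|((y - x) 0 i + 1)%R|%N] => //.
apply/rowP => i; rewrite !mxE ffunE inordK.
  have := enorm1_le i y1; rewrite !mxE.
  by move: (y 0 i) (x 0 i) => a b; lia.
have := enorm1_le i y1; rewrite !mxE.
by move: (y 0 i) (x 0 i) => a b; lia.
Qed.

End Schroedinger.

Arguments enorm R {d} x.
Arguments laplacian {R d} f x.
Arguments schroedinger {R d} V f x.
Arguments H_harmonic {R d} V u.
Arguments positive_schroedinger {R d} V.
Arguments inO {R d} f g.

Section Arcosh.
Variable R : realType.
Implicit Types x y t : R.

Definition cosh t : R := (expR t + expR (- t)) / 2.

Definition arcosh x : R := get [set t | 0 <= t /\ cosh t = x].

Lemma cosh_inj x y : 0 <= x -> 0 <= y -> cosh x = cosh y -> x = y.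
Proof.
move=> x0 y0; rewrite /cosh !expRN => h; apply: expR_inj.
have := expR_ge1Dx x; have := expR_ge1Dx y.
move: (expR x) (expR y) (expR_gt0 x) (expR_gt0 y) h => a b a0 b0 h b1 a1.
have : (a - b) * (a * b - 1) = 0.
  have -> : (a - b) * (a * b - 1) = (a + a^-1 - (b + b^-1)) * (a * b).
    by field; rewrite !gt_eqF.
  by rewrite [a + _](_ : _ = b + b^-1) ?subrr ?mul0r//; lra.
move/eqP; rewrite mulf_eq0 => /orP[/eqP|/eqP]; first by lra.
by nra.
Qed.

Lemma arcoshK x : 1 <= x -> 0 <= arcosh x /\ cosh (arcosh x) = x.
Proof.
move=> x1; rewrite /arcosh.
have := sqrtr_ge0 (x ^+ 2 - 1); have : Num.sqrt (x ^+ 2 - 1) ^+ 2 = x ^+ 2 - 1.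
  by rewrite sqr_sqrtr//; nra.
move: (Num.sqrt _) => s s2 s0.
suff : [set t | 0 <= t /\ cosh t = x] (ln (x + s)) by exact: getI.
split; first by rewrite ln_ge0//; lra.
rewrite /cosh expRN lnK ?posrE; last by lra.
have xs0 : x + s != 0 by rewrite gt_eqF//; lra.
have -> : (x + s)^-1 = x - s.
  by apply: (mulfI xs0); rewrite mulfV// mulrC -subr_sqr s2; ring.
by field.
Qed.

Lemma arcosh32_lt1 : arcosh (3 / 2) < 1.
Proof.
have [] : 0 <= arcosh (3 / 2) /\ cosh (arcosh (3 / 2)) = 3 / 2.
  by apply: arcoshK; lra.
move: (arcosh _) => t t0; rewrite /cosh expRN => ht.
rewrite ltNge; apply/negP => t1.
have e16 : (17 / 16) ^+ 16 <= expR 1 :> R.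
  rewrite [X in expR X](_ : 1 = 16%:R * (1 / 16)); last by field.
  rewrite expRM_natl; apply: lerXn2r; rewrite ?nnegrE ?expR_ge0 ?divr_ge0//.
  by rewrite (le_trans _ (expR_ge1Dx _))//; lra.
have : 263 / 100 <= expR t.
  by rewrite (le_trans _ (le_trans e16 _)) ?ler_expR//; lra.
move: (expR t) (expR_gt0 t) ht => a a0 ht a1.
have : a ^+ 2 + 1 = 3 * a.
  have -> : a ^+ 2 + 1 = (a + a^-1) * a by field; rewrite gt_eqF.
  by rewrite [a + _](_ : _ = 3)//; lra.
by nra.
Qed.

End Arcosh.

(* Main.v *)
Require Import Defs.
From mathcomp Require Import all_boot all_order all_algebra.
From mathcomp Require Import all_classical all_reals all_analysis.
From mathcomp Require Import ring lra zify.

Import Order.TTheory GRing.Theory Num.Theory.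
Import numFieldNormedType.Exports.
Local Open Scope classical_set_scope.
Local Open Scope ring_scope.

Set Implicit Arguments.
Unset Strict Implicit.
Unset Printing Implicit Defensive.

(** The theorem combines a Liouville principle with a lower bound for positive
    supersolutions.

    Let [w] be the nontrivial nonnegative function with [Hw >= 0]; it is
    positive everywhere, since at a zero all neighbours are zeros too
    ([supersolution_gt0]).

    Liouville principle ([liouville]): [u = c w].  Write [v = u / w].  Testing
    [Hu = 0] against [eta^2 u] for a finitely supported cutoff [eta] gives a
    Caccioppoli inequality ([caccioppoli])
      [sum w w' (eta v - eta' v')^2 <= sum u u' (eta - eta')^2]
    over the edges of the lattice.  The growth hypotheses say that
    [u^2 = O(r^(2-d))] at distance [r], and a sphere of radius [r] has
    [O(r^(d-1))] points, so a radial cutoff with increments [t_r] has energy at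
    most a constant times [sum r t_r^2].  With [t_r] proportional to [1/r]
    (a logarithmic cutoff, [log_cutoff]) this is one over a partial sum of the
    harmonic series, hence tends to [0], and [v] is constant.  The argument is
    the same in every dimension; recurrence for [d <= 2] and the Hardy weight for
    [d >= 3] both show up as this one divergent series.

    Lower bound ([axis_lower_bound]): [w(M e_j) >= b kappa^M M^(-(d-1)/2)] for
    some [b > 0], where [kappa = exp(-lambda)] is the root in [(0,1)] of
    [kappa^2 + 1 = 3 kappa].  As [V <= 1], the function [w] is a supersolution of
    [Delta + 1], that is, of the walk killed with probability [1/(2d+1)] at each
    step.  Instead of analysing its Green function, consider the distribution of
    the point where the walk from [0] first hits the hyperplane [x_j = -1].
    It is the limit of finitely supported measures [mu_m] defined by
      [mu_(m+1) = (delta_(-e_j) + transverse steps of mu_m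
                   + mu_m * mu_m shifted by e_j) / (2d+1)],
    where the last term accounts for a first step away from the hyperplane, after
    which two levels must be descended.  The mass [m] of these measures obeys a
    scalar recursion with limit [kappa], the transverse variance stays bounded,
    and [w] dominates its averages against [mu_m] and against convolution powers
    of [mu_m].  By Chebyshev at least half of the mass of the [N]-th power [p] of
    [mu_m] sits on [O(N^((d-1)/2))] points, so by Cauchy-Schwarz [sum p(z)^2] is
    at least a constant times [mass^(2N) N^(-(d-1)/2)]; by reflection symmetry
    this sum is the weight with which [2N] descents from [2N e_j] end at [0]
    ([kernel_return]).  Letting [m] tend to infinity gives the bound
    ([even_axis_lower_bound]).

    If [c] were nonzero, the lower bound for [w] would bound
    [|u(M e_j)| M^((d-1)/2) e^(lambda M)] below by a positive constant. *)

(** * Nearest neighbours in the lattice *)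

Section Lattice.
Variables (R : realType) (d : nat).
Implicit Types (x y z : 'rV[int]_d) (f : 'rV[int]_d -> R).

Lemma unit_vecE (i k : 'I_d) : ('e_i : 'rV[int]_d) 0 k = (k == i)%:R.
Proof. by rewrite mxE eqxx. Qed.

Lemma enorm_unit (i : 'I_d) : enorm R ('e_i : 'rV[int]_d) = 1.
Proof.
rewrite /enorm (bigD1 i)//= unit_vecE eqxx big1 => [|k ki].
  by rewrite addr0 expr1n sqrtr1.
by rewrite unit_vecE (negbTE ki) expr0n.
Qed.

Lemma enormN x : enorm R (- x) = enorm R x.
Proof. by congr Num.sqrt; apply: eq_bigr => i _; rewrite mxE mulrNz sqrrN. Qed.

Lemma enorm1P x : enorm R x = 1 <->
  exists i, x = 'e_i \/ x = - 'e_i.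
Proof.
split; last by case=> i [] ->; rewrite ?enormN enorm_unit.
move=> x1; have [i xi0] : exists i, x 0 i != 0.
  apply: contrapT => /forallNP x0.
  move: x1; rewrite /enorm big1 ?sqrtr0 => [/esym/eqP|i _]; first by rewrite oner_eq0.
  by have /negP := x0 i; rewrite negbK => /eqP ->; rewrite expr0n.
have xi1 : x 0 i = 1 \/ x 0 i = -1 by have := enorm1_le i x1; move: xi0; lia.
have xk0 k : k != i -> x 0 k = 0.
  move=> ki; have := congr1 (fun t : R => t ^+ 2) x1.
  rewrite /enorm sqr_sqrtr ?expr1n; last by apply: sumr_ge0 => j _; apply: sqr_ge0.
  rewrite (bigD1 i)//= (bigD1 k)//= => e1.
  have i1 : ((x 0 i)%:~R : R) ^+ 2 = 1.
    by case: xi1 => ->; rewrite ?mulrNz ?sqrrN expr1n.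
  have := sqr_ge0 ((x 0 k)%:~R : R).
  have : 0 <= \sum_(j < d | (j != i) && (j != k)) ((x 0 j)%:~R : R) ^+ 2.
    by apply: sumr_ge0 => j _; apply: sqr_ge0.
  move=> s0 k0; have /eqP : ((x 0 k)%:~R : R) ^+ 2 = 0 by lra.
  by rewrite sqrf_eq0 intr_eq0 => /eqP.
exists i; case: xi1 => xi.
- left; apply/rowP => k; rewrite unit_vecE.
  by have [->|/xk0 ->] := eqVneq k i.
- right; apply/rowP => k; rewrite mxE unit_vecE.
  by have [->|/xk0 ->] := eqVneq k i; rewrite ?oppr0.
Qed.

Lemma laplacianE f x : laplacian f x =
  \sum_(i < d) ((f x - f (x + 'e_i)) + (f x - f (x - 'e_i))).
Proof.
pose s := [seq x + 'e_i | i <- enum 'I_d] ++ [seq x - 'e_i | i <- enum 'I_d].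
have unit_inj : injective (fun i : 'I_d => 'e_i : 'rV[int]_d).
  move=> i k /(congr1 (fun z : 'rV_d => z 0 i)); rewrite !unit_vecE eqxx.
  by case: eqVneq.
have us : uniq s.
  rewrite cat_uniq !map_inj_uniq //.
  - rewrite -!enumT !enum_uniq andbT /=; apply/negP => /hasP[_ /mapP[i _ ->] /mapP[k _]].
    move=> /addrI /(congr1 (fun z : 'rV_d => z 0 i)).
    by rewrite mxE !unit_vecE eqxx; case: eqVneq.
  - by move=> i k /addrI/oppr_inj/unit_inj.
  - by move=> i k /addrI/unit_inj.
rewrite /laplacian (@eq_fsbigl _ _ _ _ _ _ [set` s]).
  rewrite -fsbig_seq// big_cat !big_map /= [RHS]big_split /=.
  by congr (_ + _); rewrite -[RHS]big_enum.
apply/seteqP; split=> y /=; rewrite enorm1P mem_cat.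
  move=> [i [] yx]; apply/orP; [left|right]; apply/mapP; exists i;
    rewrite ?mem_enum//; apply/eqP; by rewrite addrC -subr_eq yx.
by move=> /orP[] /mapP[i _ ->]; exists i; rewrite addrAC subrr add0r; [left|right].
Qed.

End Lattice.

(** * Connectedness, sup norm, slabs and shells *)

Section SupNorm.
Variables (d : nat).
Implicit Types (x y z : 'rV[int]_d).

(** Connectedness of the lattice, as an induction principle. *)
Lemma lattice_ind (P : 'rV[int]_d -> Prop) x y :
  (forall z i, P z -> P (z + 'e_i)) -> (forall z i, P z -> P (z - 'e_i)) ->
  P x -> P y.
Proof.
move=> Padd Psub Px.
have step z i (a : int) : P z -> P (z + a *: 'e_i).
  case: a => n Pz.
    elim: n => [|n IH]; first by rewrite scale0r addr0.
    by rewrite intS scalerDl scale1r addrCA addrC; apply: Padd.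
  rewrite NegzE scaleNr; elim: n => [|n IH]; first by rewrite scale1r; apply: Psub.
  by rewrite intS scalerDl scale1r opprD addrCA addrC; apply: Psub.
suff H (s : seq 'I_d) : P (x + \sum_(i <- s) (y - x) 0 i *: 'e_i).
  by have := H (index_enum 'I_d); rewrite -row_sum_delta addrC subrK.
elim: s => [|i s IH]; first by rewrite big_nil addr0.
by rewrite big_cons addrCA addrC; apply: step.
Qed.

Definition supn x : nat := \max_(i < d) `|x 0%R i|%N.

Lemma leq_supn x i : (`|x 0%R i| <= supn x)%N.
Proof. exact: (@leq_bigmax_cond _ predT (fun i => `|x 0%R i|%N)). Qed.

Lemma supn_leq x n : (forall i, (`|x 0%R i| <= n)%N) -> (supn x <= n)%N.
Proof. by move=> xn; apply/bigmax_leqP => i _; apply: xn. Qed.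

Lemma supnDe x i : (supn (x + 'e_i) <= (supn x).+1)%N.
Proof.
apply: supn_leq => k; rewrite mxE unit_vecE.
by have := leq_supn x k; case: (k == i) => /=; move: (x 0 k) => a; lia.
Qed.

Lemma supnBe x i : (supn (x - 'e_i) <= (supn x).+1)%N.
Proof.
apply: supn_leq => k; rewrite !mxE eqxx /=.
by have := leq_supn x k; case: (k == i) => /=; move: (x 0 k) => a; lia.
Qed.

Lemma supn_leDe x i : (supn x <= (supn (x + 'e_i)).+1)%N.
Proof. by rewrite -{1}(addrK 'e_i x) supnBe. Qed.

Lemma supn_leBe x i : (supn x <= (supn (x - 'e_i)).+1)%N.
Proof. by rewrite -{1}(subrK 'e_i x) supnDe. Qed.

End SupNorm.

Section Shells.
Variables (R : realType) (n : nat).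
Local Notation lattice := 'rV[int]_n.+1.
Implicit Types (x y z : lattice) (f : lattice -> R).

Lemma supn_attained x : exists i, supn x = `|x 0%R i|%N.
Proof.
have [|i xi] := @bigop.eq_bigmax _ (fun i : 'I_n.+1 => `|x 0%R i|%N);
  first by rewrite card_ord.
by exists i.
Qed.

(** The points [x] with [x_j = c] and all other coordinates at most [r] in absolute
    value.  Slabs serve twice: the faces of the sup-norm spheres are slabs, and so
    are the sets on which the kernels below concentrate. *)
Definition slab (j : 'I_n.+1) (c : int) (r : nat) : seq lattice :=
  [seq \row_i (if unlift j i is Some k then (g k)%:Z - r%:Z else c)
  | g : {ffun 'I_n -> 'I_r.*2.+1} <- enum {: {ffun 'I_n -> 'I_r.*2.+1}}].

Lemma size_slab j c r : size (slab j c r) = (r.*2.+1 ^ n)%N.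
Proof. by rewrite size_map -cardE card_ffun !card_ord. Qed.

Lemma mem_slab j c r x :
  x \in slab j c r <-> x 0 j = c /\ forall k, k != j -> (`|x 0%R k| <= r)%N.
Proof.
split=> [/mapP[g _ ->]|[xj xk]].
  split; first by rewrite mxE unlift_none.
  move=> k; rewrite eq_sym => /unlift_some[k' -> ku].
  rewrite mxE ku; have := ltn_ord (g k'); move: (nat_of_ord (g k')) => a; lia.
apply/mapP; exists [ffun k : 'I_n => inord `|(x 0 (lift j k) + r%:Z)%R|%N].
  by rewrite mem_enum.
apply/rowP => i; rewrite mxE.
case: unliftP => [k ->|->//].
rewrite ffunE; have : (`|x 0%R (lift j k)| <= r)%N by apply: xk; rewrite eq_sym neq_lift.
by move: (fun_of_matrix x _ _) => a ar; rewrite inordK; lia.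
Qed.

(** The sup-norm ball of radius [N - 1], listed sphere by sphere and each sphere
    face by face.  Points on edges are repeated, which does no harm in
    upper bounds; [undup] removes the repetitions. *)
Definition shells (N : nat) : seq lattice :=
  [seq x | r <- iota 0 N, x <- flatten
    [seq slab i r%:Z r ++ slab i (- r%:Z) r | i <- enum 'I_n.+1]].

Lemma mem_shells N x : (supn x < N)%N -> x \in shells N.
Proof.
move=> xN; apply/allpairsPdep; exists (supn x), x; split=> //.
  by rewrite mem_iota.
have [i xi] := supn_attained x.
apply/flatten_mapP; exists i; first by rewrite mem_enum.
have xr k : k != i -> (`|x 0%R k| <= supn x)%N by move=> _; apply: leq_supn.
have [xi0|xi0] := leP 0 (x 0 i); rewrite mem_cat; apply/orP; [left|right];
  by apply/mem_slab; split=> //; rewrite xi; move: xi0; lia.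
Qed.

Lemma supn_slab i (c : int) r x : `|c|%N = r -> x \in slab i c r -> supn x = r.
Proof.
move=> cr /mem_slab[xi xk]; apply/eqP; rewrite eqn_leq; apply/andP; split.
  by apply: supn_leq => k; have [->|/xk//] := eqVneq k i; rewrite xi cr.
by rewrite -cr -xi leq_supn.
Qed.

Lemma sum_undup_le (T : eqType) (s : seq T) (f : T -> R) :
  (forall a, 0 <= f a) -> \sum_(a <- undup s) f a <= \sum_(a <- s) f a.
Proof.
move=> f0; elim: s => [|a s IH] //=; rewrite big_cons.
by case: ifP => _; rewrite ?big_cons ?lerD2l// ler_wpDl.
Qed.

Lemma sumr_const_seq (T : Type) (s : seq T) (b : R) :
  \sum_(i <- s) b = (size s)%:R * b.
Proof. by rewrite big_const_seq count_predT iter_addr_0 mulr_natl. Qed.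

Lemma sum_slab_le i (c : int) r f (b : R) : `|c|%N = r ->
  (forall x, supn x = r -> f x <= b) ->
  \sum_(x <- slab i c r) f x <= (r.*2.+1 ^ n)%:R * b.
Proof.
move=> cr fb; rewrite -(size_slab i c) -sumr_const_seq.
rewrite [leLHS]big_seq [leRHS]big_seq; apply: ler_sum => x xs.
by apply: fb; apply: supn_slab xs.
Qed.

(** Polar coordinates: the sphere of radius [r] has [2 (n + 1)] faces of
    [(2 r + 1)^n] points each. *)
Lemma sum_shells_le N f (phi : nat -> R) :
  (forall x, 0 <= f x) -> (forall x, f x <= phi (supn x)) ->
  \sum_(x <- undup (shells N)) f x <=
  \sum_(0 <= r < N) (2 * n.+1 * r.*2.+1 ^ n)%:R * phi r.
Proof.
move=> f0 fphi; apply: le_trans (sum_undup_le _ f0) _.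
rewrite /shells big_allpairs_dep /index_iota subn0; apply: ler_sum => r _.
rewrite big_flatten big_map /=.
have b x : supn x = r -> f x <= phi r by move=> <-.
rewrite (le_trans (y := \sum_(i <- enum 'I_n.+1) 2 * ((r.*2.+1 ^ n)%:R * phi r)))//.
  apply: ler_sum => i _; rewrite big_cat /= mulr2n mulrDl !mul1r.
  by apply: lerD; apply: sum_slab_le b; lia.
by rewrite sumr_const_seq -cardE card_ord !natrM !mulrA (mulrC 2).
Qed.

(** Translation invariance of the counting measure, in the form needed for
    summation by parts: the support of [F] and its translate both lie in [L]. *)
Lemma sum_shift (L : seq lattice) (F : lattice -> R) (a : lattice) : uniq L ->
  (forall x, F x != 0 -> x \in L) -> (forall x, F (x + a) != 0 -> x \in L) ->
  \sum_(x <- L) F (x + a) = \sum_(x <- L) F x.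
Proof.
move=> uL FL FaL.
have sumT (G : lattice -> R) : (forall x, G x != 0 -> x \in L) ->
    \sum_(x <- L) G x = \sum_(x \in [set: lattice]) G x.
  move=> GL; rewrite fsbig_seq//.
  apply: fsbig_widen => // x [_ /= xL].
  by apply/eqP; apply: contra_notT xL; apply: GL.
rewrite !sumT//; apply/esym/reindex_fsbigT.
by exists (fun x => x - a) => x; rewrite ?addrK ?subrK.
Qed.

End Shells.

(** * A Liouville theorem for positive supersolutions *)

Section Liouville.
Variables (R : realType) (n : nat).
Local Notation lattice := 'rV[int]_n.+1.
Implicit Types (x y z : lattice) (u v w V eta : lattice -> R).

Lemma supersolution_gt0 V w : (exists x, w x != 0) -> (forall x, 0 <= w x) ->
  (forall x, 0 <= schroedinger V w x) -> forall x, 0 < w x.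
Proof.
move=> [x0 wx0] w0 Hw x; rewrite lt_neqAle w0 andbT eq_sym; apply/negP => /eqP wx.
have nbr z : w z = 0 -> forall i, w (z + 'e_i) = 0 /\ w (z - 'e_i) = 0.
  move=> wz i; have := Hw z; rewrite /schroedinger laplacianE wz mulr0 addr0.
  rewrite (bigD1 i)//= !sub0r.
  have : \sum_(k < n.+1 | k != i) (0 - w (z + 'e_k) + (0 - w (z - 'e_k))) <= 0.
    by apply: sumr_le0 => k _; have := w0 (z + 'e_k); have := w0 (z - 'e_k); lra.
  by have := w0 (z + 'e_i); have := w0 (z - 'e_i); split; lra.
move: wx0; rewrite (@lattice_ind _ (fun z => w z = 0) x x0) ?eqxx//.
- by move=> z i /nbr => /(_ i)[].
- by move=> z i /nbr => /(_ i)[].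
Qed.

(** A discrete form of [div(w^2 grad (u/w)) = u Hw], up to sign: the potential
    cancels in [w Hu - u Hw]. *)
Lemma wronskian_sum V u w x : H_harmonic V u ->
  \sum_(i < n.+1) ((u x * w (x + 'e_i) - w x * u (x + 'e_i)) -
                   (u (x - 'e_i) * w x - w (x - 'e_i) * u x)) =
  - u x * schroedinger V w x.
Proof.
move=> /(_ x) Hu.
transitivity (w x * schroedinger V u x - u x * schroedinger V w x); last first.
  by rewrite Hu mulr0 sub0r mulNr.
rewrite /schroedinger !laplacianE.
transitivity (w x * (\sum_(i < n.+1) (u x - u (x + 'e_i) + (u x - u (x - 'e_i)))) -
  u x * (\sum_(i < n.+1) (w x - w (x + 'e_i) + (w x - w (x - 'e_i))))).
  by rewrite !mulr_sumr -sumrB; apply: eq_bigr => i _; ring.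
ring.
Qed.

(** Sum the previous identity against [g = eta^2 u / w].  The right-hand side is
    [- eta^2 u^2 / w * Hw <= 0], and summation by parts turns the left-hand side
    into a sum over edges whose summand is
    [w w' (eta v - eta' v')^2 - u u' (eta - eta')^2] with [v = u / w]. *)
Lemma caccioppoli V u w eta (L : seq lattice) :
  H_harmonic V u -> (forall x, 0 < w x) -> (forall x, 0 <= schroedinger V w x) ->
  uniq L ->
  (forall x y, eta y != 0 -> (supn x <= (supn y).+1)%N -> x \in L) ->
  \sum_(x <- L) \sum_(i < n.+1) w x * w (x + 'e_i) *
     (eta x * (u x / w x) - eta (x + 'e_i) * (u (x + 'e_i) / w (x + 'e_i))) ^+ 2 <=
  \sum_(x <- L) \sum_(i < n.+1) u x * u (x + 'e_i) * (eta x - eta (x + 'e_i)) ^+ 2.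
Proof.
move=> Hu w0 Hw uL suppL; have wN0 x : w x != 0 by rewrite gt_eqF.
pose g x := eta x ^+ 2 * (u x / w x).
pose D i x := u x * w (x + 'e_i) - w x * u (x + 'e_i).
have gL x y : g y != 0 -> (supn x <= (supn y).+1)%N -> x \in L.
  move=> gy; apply: suppL; apply: contra_neq gy => y0.
  by rewrite /g y0 expr0n mul0r.
have le0 : \sum_(x <- L) \sum_(i < n.+1) D i x * (g x - g (x + 'e_i)) <= 0.
  rewrite (_ : \sum_(x <- L) _ =
      \sum_(x <- L) g x * \sum_(i < n.+1) (D i x - D i (x - 'e_i))).
    apply: sumr_le0 => x _; rewrite /D.
    under eq_bigr => i _ do rewrite subrK.
    rewrite (wronskian_sum w x Hu) /g.
    rewrite [leLHS](_ : _ = - ((eta x * u x) ^+ 2 / w x * schroedinger V w x)).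
      by rewrite oppr_le0 mulr_ge0// divr_ge0 ?sqr_ge0// ltW.
    by field.
  transitivity (\sum_(i < n.+1) (\sum_(x <- L) g x * D i x -
      \sum_(x <- L) g (x + 'e_i) * D i (x + 'e_i - 'e_i))).
    rewrite exchange_big /=; apply: eq_bigr => i _; rewrite -sumrB.
    by apply: eq_bigr => x _; rewrite addrK; ring.
  under [RHS]eq_bigr => x _ do rewrite mulr_sumr.
  rewrite [RHS]exchange_big /=; apply: eq_bigr => i _.
  rewrite (@sum_shift _ _ _ (fun x => g x * D i (x - 'e_i)))//.
  - by rewrite -sumrB; apply: eq_bigr => x _; ring.
  - move=> x gx; apply: (gL x x) => //.
    by apply: contra_neq gx => ->; rewrite mul0r.
  - move=> x gx; apply: (gL x (x + 'e_i)); last exact: supn_leDe.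
    by apply: contra_neq gx => ->; rewrite mul0r.
rewrite -subr_le0 -sumrB; apply: le_trans le0; rewrite le_eqVlt; apply/orP; left.
apply/eqP/eq_bigr => x _; rewrite -sumrB; apply: eq_bigr => i _.
by rewrite /D /g; field; rewrite !wN0.
Qed.

Lemma growth_const_ge0 u (C : R) :
  (forall x, u x ^+ 2 * (supn x).+1%:R ^+ n.+1 <= C * (supn x).+1%:R ^+ 2) ->
  0 <= C.
Proof.
move=> uC; have := uC 0; have := sqr_ge0 (u 0).
have -> : supn (0 : lattice) = 0%N.
  by apply/eqP; rewrite -leqn0; apply: supn_leq => k; rewrite mxE.
by rewrite !expr1n !mulr1; apply: le_trans.
Qed.

(** The energy of a radial cutoff [h] with increments at most [1 / ((r + 1) H)].
    Use [u u' <= (u^2 + u'^2) / 2] and shift the second half, so that each point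
    [x] of norm [r] contributes at most a constant times [u(x)^2 / (r H)^2]; the
    growth bound and the size [r^n] of the spheres leave
    [r^n r^(1-n) / (r H)^2 = 1 / (r H^2)]. *)
Lemma cutoff_energy_le u (h : nat -> R) (H C : R) (N : nat) :
  0 < H ->
  (forall x, u x ^+ 2 * (supn x).+1%:R ^+ n.+1 <= C * (supn x).+1%:R ^+ 2) ->
  (forall r, (N <= r)%N -> h r = 0) ->
  (forall r, `|h r - h r.+1| <= r.+1%:R^-1 / H) ->
  \sum_(x <- undup (shells n N.+2)) \sum_(i < n.+1)
    u x * u (x + 'e_i) * (h (supn x) - h (supn (x + 'e_i))) ^+ 2 <=
  8 * n.+1%:R ^+ 2 * 2 ^+ n * C / H ^+ 2 * series harmonic N.+2.
Proof.
move=> H0 uC hN hlip.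
set L := undup _; have uL : uniq L by exact: undup_uniq.
have memL x : (supn x < N.+2)%N -> x \in L by move=> xN; rewrite mem_undup mem_shells.
(* For s = r - 1 the increment is at most 1 / (r H), and 1 / r <= 2 / (r + 1). *)
have lip r s : (r <= s.+1)%N -> (s <= r.+1)%N ->
    (h r - h s) ^+ 2 <= (2 / (r.+1%:R * H)) ^+ 2.
  move=> rs sr; rewrite -[leLHS]real_normK ?num_real//.
  apply: lerXn2r; rewrite ?nnegrE ?divr_ge0 ?mulr_ge0 ?(ltW H0)//.
  rewrite invfM mulrA; have r1 : 0 < r.+1%:R :> R by [].
  have [->|rsN] := eqVneq r s.
    by rewrite subrr normr0 ?mulr_ge0 ?invr_ge0 ?(ltW H0).
  have [sE|rE] : s = r.+1 \/ r = s.+1 by lia.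
    rewrite sE; apply: le_trans (hlip r) _.
    by rewrite ler_pM2r ?invr_gt0// ler_peMl ?invr_ge0// ler1n.
  rewrite rE distrC; apply: le_trans (hlip s) _; rewrite ler_pM2r ?invr_gt0//.
  rewrite ler_pdivlMr// mulrC ler_pdivrMr//.
  by rewrite -natrM ler_nat; lia.
(* The shares of x in the energies of the edges to x - e_i and x + e_i. *)
pose E i x := 2^-1 * u x ^+ 2 * (h (supn x) - h (supn (x - 'e_i))) ^+ 2.
pose F i x := 2^-1 * u x ^+ 2 * (h (supn x) - h (supn (x + 'e_i))) ^+ 2.
have EN i x : E i x != 0 -> (supn x <= N)%N.
  apply: contra_neqT; rewrite -ltnNge => Nx; have := supn_leBe x i => xx.
  by rewrite /E !hN ?subrr ?expr0n ?mulr0//; lia.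
apply: (@le_trans _ _ (\sum_(x <- L) \sum_(i < n.+1) (F i x + E i (x + 'e_i)))).
  apply: ler_sum => x _; apply: ler_sum => i _; rewrite /F /E addrK.
  have := mulr_ge0 (sqr_ge0 (u x - u (x + 'e_i))) (sqr_ge0 (h (supn x) - h (supn (x + 'e_i)))).
  by lra.
have -> : \sum_(x <- L) \sum_(i < n.+1) (F i x + E i (x + 'e_i)) =
    \sum_(x <- L) \sum_(i < n.+1) (F i x + E i x).
  rewrite exchange_big [RHS]exchange_big /=; apply: eq_bigr => i _.
  rewrite !big_split /=; congr (_ + _); apply: sum_shift => // x /EN xN; apply: memL.
    exact: leq_trans xN _.
  by have := supn_leDe x i; lia.
pose f x := n.+1%:R * (u x ^+ 2 * (2 / ((supn x).+1%:R * H)) ^+ 2).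
apply: (@le_trans _ _ (\sum_(x <- L) f x)).
  apply: ler_sum => x _; rewrite /f mulr_natl -[X in _ *+ X](card_ord n.+1) -sumr_const.
  apply: ler_sum => i _; rewrite /F /E.
  have := ler_wpM2l (sqr_ge0 (u x)) (lip _ _ (supn_leDe x i) (supnDe x i)).
  have := ler_wpM2l (sqr_ge0 (u x)) (lip _ _ (supn_leBe x i) (supnBe x i)).
  rewrite -!(mulrA 2^-1); move: (u x ^+ 2 * _) (u x ^+ 2 * _) (u x ^+ 2 * _).
  by move=> a b c; lra.
have C0 : 0 <= C := growth_const_ge0 uC.
pose phi r : R := 4 * n.+1%:R * C / H ^+ 2 / r.+1%:R ^+ n.+1.
apply: le_trans (@sum_shells_le _ _ _ f phi _ _) _.
- by move=> x; rewrite /f mulr_ge0// mulr_ge0// sqr_ge0.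
- move=> x; rewrite /f /phi; have r0 : 0 < (supn x).+1%:R :> R by [].
  have := uC x; rewrite -ler_pdivlMr ?exprn_gt0// => ux.
  apply: le_trans (ler_wpM2l (ler0n _ _) (ler_wpM2r (sqr_ge0 _) ux)) _.
  rewrite le_eqVlt; apply/orP; left; apply/eqP.
  move: ((supn x).+1%:R : R) r0 => r r0; rewrite exprS.
  by field; rewrite !gt_eqF ?exprn_gt0.
rewrite /series /= mulr_sumr; apply: ler_sum => r _.
rewrite /phi /harmonic; have r0 : 0 < r.+1%:R :> R by [].
rewrite !natrM natrX.
have : (r.*2.+1)%:R ^+ n <= (2 * r.+1%:R) ^+ n :> R.
  by rewrite lerXn2r ?nnegrE// -natrM ler_nat; lia.
have A0 : 0 <= 2 * n.+1%:R * (4 * n.+1%:R * C / H ^+ 2 / r.+1%:R ^+ n.+1) :> R.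
  by rewrite !(mulr_ge0, invr_ge0)// ?exprn_ge0 ?(ltW H0).
move=> /(ler_wpM2r A0); set lhs := (X in X <= _) => le1.
rewrite [leLHS](_ : _ = lhs); last by rewrite /lhs; ring.
apply: le_trans le1 _; rewrite le_eqVlt; apply/orP; left; apply/eqP.
rewrite exprMn; move: (r.+1%:R : R) r0 => s s0; rewrite (exprS s).
by field; rewrite !gt_eqF ?exprn_gt0.
Qed.

Lemma harmonic_unbounded (A : R) : exists N, A <= series harmonic N.
Proof.
apply: contrapT => /forallNP bnd; apply: (@dvg_harmonic R).
apply: nondecreasing_is_cvgn.
  by apply/nondecreasing_seqP => N;
    rewrite -subr_ge0 /series /= big_nat_recr//= addrAC subrr add0r.
by exists A => _ [N _ <-]; rewrite leNgt; apply/negP => /ltW; apply: bnd.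
Qed.

(** The cutoff is [(S N - S r) / H] truncated to [[0, 1]], with [S] the harmonic
    sums and [H = S N - S M]; choosing [N] so large that [S N] exceeds [2 S M]
    makes [H] comparable to [S N]. *)
Lemma log_cutoff (M : nat) (A : R) : 0 < A ->
  exists (N : nat) (h : nat -> R) (H : R),
  [/\ A <= H, series harmonic N.+2 <= 2 * H,
      forall r, (r <= M)%N -> h r = 1, forall r, (N <= r)%N -> h r = 0 &
      forall r, `|h r - h r.+1| <= r.+1%:R^-1 / H].
Proof.
move=> A0; pose S : nat -> R := series harmonic.
have SS r : S r.+1 = S r + r.+1%:R^-1 by rewrite /S /series /= big_nat_recr.
have SM : {homo S : r s / (r <= s)%N >-> r <= s}.
  by apply/nondecreasing_seqP => r; rewrite SS lerDl invr_ge0.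
have [N SN] := harmonic_unbounded (2 * S M + 2 + A).
pose H := S N - S M.
have SM0 : 0 <= S M by have := SM _ _ (leq0n M); rewrite {1}/S /series /= big_geq.
have H0 : 0 < H by rewrite /H; move: SN; rewrite -/(S N); lra.
exists N, (fun r => Num.min 1 (Num.max 0 ((S N - S r) / H))), H; split.
- by rewrite /H; move: SN; rewrite -/(S N); lra.
- rewrite -/(S N.+2) !SS /H; move: SN; rewrite -/(S N).
  have : N.+1%:R^-1 <= 1 :> R by rewrite invf_le1// ler1n.
  have : N.+2%:R^-1 <= 1 :> R by rewrite invf_le1// ler1n.
  by move: N.+2%:R^-1 N.+1%:R^-1 => a b; lra.
- move=> r /SM rM; have : 1 <= (S N - S r) / H by rewrite ler_pdivlMr// /H; lra.
  by move=> h1; rewrite max_r ?min_l//; lra.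
- move=> r /SM rN; have : (S N - S r) / H <= 0.
    by rewrite pmulr_lle0 ?invr_gt0//; lra.
  by move=> h0; rewrite max_l ?min_r//; lra.
- move=> r; have -> : r.+1%:R^-1 / H = (S N - S r) / H - (S N - S r.+1) / H.
    by rewrite SS; field; rewrite !gt_eqF.
  have : (S N - S r.+1) / H <= (S N - S r) / H.
    by rewrite ler_pM2r ?invr_gt0// SS lerD2l lerN2 lerDl invr_ge0.
  move: (_ / H) (_ / H) => a b ba.
  rewrite ger0_norm; last by rewrite subr_ge0 /Num.min /Num.max; repeat case: ifP; lra.
  by rewrite /Num.min /Num.max; repeat case: ifP; lra.
Qed.

(** On edges where the cutoff is [1] the Caccioppoli inequality bounds
    [w w' (v - v')^2] by a constant over [A], for every [A]. *)
Lemma liouville V u w (C : R) :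
  H_harmonic V u -> (forall x, 0 < w x) -> (forall x, 0 <= schroedinger V w x) ->
  (forall x, u x ^+ 2 * (supn x).+1%:R ^+ n.+1 <= C * (supn x).+1%:R ^+ 2) ->
  exists c, forall x, u x = c * w x.
Proof.
move=> Hu w0 Hw uC; have wN0 x : w x != 0 by rewrite gt_eqF.
pose v x := u x / w x.
have energy x : exists K, forall A, 0 < A -> forall i,
    w x * w (x + 'e_i) * (v x - v (x + 'e_i)) ^+ 2 <= K / A.
  exists (16 * n.+1%:R ^+ 2 * 2 ^+ n * C) => A A0 i.
  have [N [h [H [AH HH h1 h0 hlip]]]] := log_cutoff (supn x).+1 A0.
  have H0 : 0 < H by apply: lt_le_trans AH.
  pose L := undup (shells n N.+2).
  have suppL y1 y2 : h (supn y2) != 0 -> (supn y1 <= (supn y2).+1)%N -> y1 \in L.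
    move=> hy y12; rewrite mem_undup mem_shells//.
    by rewrite ltnNge; apply: contra_neqN hy => Ny; rewrite h0//; lia.
  have := caccioppoli Hu w0 Hw (undup_uniq _) suppL.
  move/le_trans => /(_ _ (cutoff_energy_le H0 uC h0 hlip)) E.
  have xL : x \in L by apply: (suppL x x) => //; rewrite h1 ?oner_eq0//; lia.
  have pos (z : lattice) (k : 'I_n.+1) : 0 <= w z * w (z + 'e_k) *
     (h (supn z) * (u z / w z) - h (supn (z + 'e_k)) * (u (z + 'e_k) / w (z + 'e_k))) ^+ 2.
    by rewrite mulr_ge0 ?sqr_ge0// mulr_ge0// ltW.
  rewrite (bigD1_seq x) ?undup_uniq//= (bigD1 i)//= in E.
  have E1 : 0 <= \sum_(z <- L | z != x) \sum_(k < n.+1) w z * w (z + 'e_k) *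
     (h (supn z) * (u z / w z) - h (supn (z + 'e_k)) * (u (z + 'e_k) / w (z + 'e_k))) ^+ 2.
    by apply: sumr_ge0 => z _; apply: sumr_ge0 => k _; apply: pos.
  have E2 : 0 <= \sum_(k < n.+1 | k != i) w x * w (x + 'e_k) *
     (h (supn x) * (u x / w x) - h (supn (x + 'e_k)) * (u (x + 'e_k) / w (x + 'e_k))) ^+ 2.
    by apply: sumr_ge0 => k _; apply: pos.
  rewrite (h1 (supn x))// (h1 (supn (x + 'e_i))) ?supnDe// !mul1r in E.
  rewrite (h1 (supn x))// mul1r in E2.
  have C0 : 0 <= C := growth_const_ge0 uC.
  have K0 : 0 <= 8 * n.+1%:R ^+ 2 * 2 ^+ n * C :> R.
    by rewrite mulr_ge0// mulr_ge0 ?exprn_ge0// mulr_ge0 ?exprn_ge0.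
  have KE : 8 * n.+1%:R ^+ 2 * 2 ^+ n * C / H ^+ 2 * series harmonic N.+2 <=
      16 * n.+1%:R ^+ 2 * 2 ^+ n * C / A.
    apply: (@le_trans _ _ (8 * n.+1%:R ^+ 2 * 2 ^+ n * C / H ^+ 2 * (2 * H))).
      by rewrite ler_wpM2l// divr_ge0 ?exprn_ge0// ltW.
    rewrite (_ : _ * (2 * H) = 2 * (8 * n.+1%:R ^+ 2 * 2 ^+ n * C) / H); last first.
      by field; rewrite gt_eqF.
    rewrite (_ : 16 * _ ^+ 2 * _ * C = 2 * (8 * n.+1%:R ^+ 2 * 2 ^+ n * C)); last by ring.
    by rewrite ler_wpM2l ?mulr_ge0// lef_pV2 ?posrE.
  have := le_trans E KE; rewrite -addrA; apply: le_trans.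
  by rewrite lerDl addr_ge0.
have vE x i : v (x + 'e_i) = v x.
  have [K EK] := energy x; apply/esym/eqP; rewrite -subr_eq0 -sqrf_eq0 eq_le sqr_ge0 andbT.
  have ww : 0 < w x * w (x + 'e_i) by rewrite mulr_gt0.
  rewrite -(pmulr_rle0 _ ww) leNgt; apply/negP; set a := w x * _ * _ => a0.
  have K1 : 0 < `|K| + 1 by rewrite ltr_wpDl.
  have := EK ((`|K| + 1) / a) (divr_gt0 K1 a0) i; rewrite -/a invf_div mulrA.
  rewrite ler_pdivlMr// mulrC ler_pM2r// => KK.
  by have := ler_norm K; lra.
exists (v 0) => x; have <- : v x = v 0; last by rewrite /v divfK.
apply: (@lattice_ind _ (fun z => v z = v 0) 0) => // z i <-; first by rewrite vE.
by rewrite -(vE _ i) subrK.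
Qed.
End Liouville.

(** * Finitely supported measures dominated by a supersolution *)

Section Kernels.
Variables (R : realType) (n : nat).
Local Notation lattice := 'rV[int]_n.+1.
Implicit Types (x y z a b : lattice) (f g : lattice -> R) (mu nu : seq (R * lattice)).

(** A list of weighted points stands for a finitely supported measure; points may
    be repeated, so only integrals are meaningful. *)
Definition integ mu f : R := \sum_(p <- mu) p.1 * f p.2.

Lemma integ_cons p mu f : integ (p :: mu) f = p.1 * f p.2 + integ mu f.
Proof. exact: big_cons. Qed.

Lemma integ_cat mu nu f : integ (mu ++ nu) f = integ mu f + integ nu f.
Proof. exact: big_cat. Qed.

Lemma eq_integ mu f g : (forall x, f x = g x) -> integ mu f = integ mu g.
Proof. by move=> fg; apply: eq_bigr => p _; rewrite fg. Qed.

Lemma integD mu f g : integ mu (fun x => f x + g x) = integ mu f + integ mu g.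
Proof. by rewrite -big_split; apply: eq_bigr => p _; rewrite mulrDr. Qed.

Lemma integZ mu c f : integ mu (fun x => c * f x) = c * integ mu f.
Proof. by rewrite /integ mulr_sumr; apply: eq_bigr => p _; rewrite mulrCA. Qed.

Lemma integ_sum (I : Type) (s : seq I) mu (F : I -> lattice -> R) :
  integ mu (fun x => \sum_(i <- s) F i x) = \sum_(i <- s) integ mu (F i).
Proof. by rewrite exchange_big; apply: eq_bigr => p _; rewrite mulr_sumr. Qed.

Definition translate a mu := [seq (p.1, a + p.2) | p <- mu].
Definition dilate (c : R) mu := [seq (c * p.1, p.2) | p <- mu].
Definition conv mu nu := [seq (p.1 * q.1, p.2 + q.2) | p <- mu, q <- nu].

Lemma integ_translate a mu f : integ (translate a mu) f = integ mu (fun x => f (a + x)).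
Proof. exact: big_map. Qed.

Lemma integ_dilate c mu f : integ (dilate c mu) f = c * integ mu f.
Proof. by rewrite /integ big_map mulr_sumr; apply: eq_bigr => p _; rewrite mulrA. Qed.

Lemma integ_conv mu nu f :
  integ (conv mu nu) f = integ mu (fun x => integ nu (fun y => f (x + y))).
Proof.
rewrite /integ big_allpairs_dep; apply: eq_bigr => p _.
by rewrite mulr_sumr; apply: eq_bigr => q _; rewrite mulrA.
Qed.

Variables (j : 'I_n.+1) (w : lattice -> R).
Hypothesis w0 : forall x, 0 < w x.
Hypothesis w_super : forall x,
  \sum_(i < n.+1) (w (x + 'e_i) + w (x - 'e_i)) <= (2 * n + 3)%:R * w x.

(** Reflection in the axis spanned by [e_j]: it fixes the [j]-th coordinate and
    changes the sign of the others. *)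
Definition reflect_off z : lattice := \row_i (if i == j then z 0 i else - z 0 i).

Lemma reflect_offD x y : reflect_off (x + y) = reflect_off x + reflect_off y.
Proof. by apply/rowP => i; rewrite !mxE; case: ifP => // _; rewrite opprD. Qed.

Lemma reflect_offN x : reflect_off (- x) = - reflect_off x.
Proof. by apply/rowP => i; rewrite !mxE; case: ifP. Qed.

Lemma reflect_off_axis : reflect_off 'e_j = 'e_j.
Proof. by apply/rowP => i; rewrite !mxE !eqxx /=; case: eqVneq. Qed.

Lemma reflect_off_lift k : reflect_off 'e_(lift j k) = - 'e_(lift j k).
Proof.
apply/rowP => i; rewrite !mxE eqxx /=; case: (eqVneq i j) => // ->.
by rewrite (negbTE (neq_lift _ _)).
Qed.

(** Measures of mass [m] on the hyperplane [x_j = c], symmetric under reflection in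
    the axis, whose averages of [w] around any point stay below [w] at that
    point. *)
Record kernel (c : int) (m : R) mu : Prop := Kernel {
  kernel_ge0 : forall p, p \in mu -> 0 <= p.1;
  kernel_level : forall p, p \in mu -> p.2 0 j = c;
  kernel_submean : forall x, integ mu (fun z => w (x + z)) <= w x;
  kernel_sym : forall f, integ mu (fun z => f (reflect_off z)) = integ mu f;
  kernel_mass : integ mu (fun=> 1) = m }.

Lemma le_integ c m mu f g : kernel c m mu ->
  (forall z, z 0 j = c -> f z <= g z) -> integ mu f <= integ mu g.
Proof.
move=> K fg; rewrite /integ [leLHS]big_seq [leRHS]big_seq; apply: ler_sum => p pmu.
by rewrite ler_wpM2l ?(kernel_ge0 K)// fg// (kernel_level K).
Qed.

Lemma kernel_mass_ge0 c m mu : kernel c m mu -> 0 <= m.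
Proof.
move=> K; rewrite -(kernel_mass K) /integ big_seq; apply: sumr_ge0 => p pmu.
by rewrite mulr1 (kernel_ge0 K).
Qed.

Lemma integ_cst c m mu (t : R) : kernel c m mu -> integ mu (fun=> t) = t * m.
Proof.
move=> K; rewrite -(kernel_mass K) -integZ; apply: eq_integ => z.
by rewrite mulr1.
Qed.

Lemma kernel_conv c m mu c' m' nu : kernel c m mu -> kernel c' m' nu ->
  kernel (c + c') (m * m') (conv mu nu).
Proof.
move=> K K'; split.
- move=> _ /allpairsP[[p q] [/= pm qm ->]] /=.
  by rewrite mulr_ge0 ?(kernel_ge0 K pm) ?(kernel_ge0 K' qm).
- move=> _ /allpairsP[[p q] [/= pm qm ->]] /=.
  by rewrite mxE (kernel_level K pm) (kernel_level K' qm).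
- move=> x; rewrite integ_conv; apply: le_trans (kernel_submean K x).
  apply: (le_integ K) => z _; apply: le_trans (kernel_submean K' _).
  by rewrite le_eqVlt (@eq_integ _ _ (fun z' => w (x + z + z'))) ?eqxx// => z'; rewrite addrA.
- move=> f; rewrite !integ_conv.
  rewrite -(kernel_sym K (fun x => integ nu (fun y => f (x + y)))).
  apply: eq_integ => x; rewrite -(kernel_sym K' (fun y => f (reflect_off x + y))).
  by apply: eq_integ => y; rewrite reflect_offD.
- rewrite integ_conv -[m * _]mulrC -(integ_cst _ K); apply: eq_integ => x.
  exact: kernel_mass K'.
Qed.

Lemma kernel1 : kernel 0 1 [:: (1, 0)].
Proof.
split.
- by move=> p; rewrite inE => /eqP -> /=.
- by move=> p; rewrite inE => /eqP -> /=; rewrite mxE.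
- by move=> x; rewrite /integ big_seq1 mul1r addr0.
- move=> f; rewrite /integ !big_seq1; congr (_ * f _).
  by apply/rowP => i; rewrite !mxE oppr0; case: ifP.
- by rewrite /integ big_seq1 mul1r.
Qed.

Lemma kernel0 : kernel (-1) 0 [::].
Proof.
by split=> // [x|f|]; rewrite /integ !big_nil// ltW.
Qed.

Definition coord (k : 'I_n) z : R := (z 0 (lift j k))%:~R.
Definition moment2 k mu : R := integ mu (fun z => coord k z ^+ 2).

Lemma coordD k x y : coord k (x + y) = coord k x + coord k y.
Proof. by rewrite /coord mxE intrD. Qed.

(** Reflection changes the sign of a transverse coordinate, so its mean is zero;
    this makes second moments additive under convolution. *)
Lemma integ_coord c m mu k : kernel c m mu -> integ mu (coord k) = 0.
Proof.
move=> K; have := kernel_sym K (coord k).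
rewrite (@eq_integ _ _ (fun z => -1 * coord k z)); last first.
  by move=> z; rewrite /coord mxE eq_sym (negbTE (neq_lift _ _)) mulrNz mulN1r.
by rewrite integZ; lra.
Qed.

Lemma moment2_translate c m mu a k : kernel c m mu ->
  integ mu (fun z => coord k (a + z) ^+ 2) = moment2 k mu + coord k a ^+ 2 * m.
Proof.
move=> K; transitivity (integ mu (fun z => coord k a ^+ 2 + (2 * coord k a * coord k z +
  coord k z ^+ 2))).
  by apply: eq_integ => z; rewrite coordD; ring.
by rewrite !integD integZ (integ_coord _ K) (integ_cst _ K) /moment2; ring.
Qed.

Lemma moment2_conv c m mu c' m' nu k : kernel c m mu -> kernel c' m' nu ->
  moment2 k (conv mu nu) = moment2 k mu * m' + m * moment2 k nu.
Proof.
move=> K K'; rewrite /moment2 integ_conv.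
under eq_integ => x do rewrite (moment2_translate x k K').
rewrite integD (integ_cst _ K) /moment2 [m * _]mulrC addrC; congr (_ + _).
by rewrite mulrC -integZ; apply: eq_integ => z; rewrite mulrC.
Qed.

(** Decomposition of a descent by one level according to its first step: straight
    down, sideways followed by a descent by one level, or up followed by two
    descents. *)
Definition kernel_step mu := dilate (2 * n + 3)%:R^-1
  ((1, - 'e_j) :: flatten [seq translate 'e_(lift j k) mu ++ translate (- 'e_(lift j k)) mu
                          | k <- enum 'I_n]
   ++ translate 'e_j (conv mu mu)).

Lemma integ_step mu f : integ (kernel_step mu) f = (2 * n + 3)%:R^-1 *
  (f (- 'e_j) + (\sum_(k < n) (integ mu (fun z => f ('e_(lift j k) + z)) +
     integ mu (fun z => f (- 'e_(lift j k) + z))) + integ (conv mu mu) (fun z => f ('e_j +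
       z)))).
Proof.
rewrite integ_dilate integ_cons mul1r integ_cat integ_translate; congr (_ * (_ + (_ + _))).
rewrite /integ big_flatten big_map big_enum; apply: eq_bigr => k _.
by rewrite -/(integ _ f) integ_cat !integ_translate.
Qed.

Lemma kernel_stepP m mu : kernel (-1) m mu ->
  kernel (-1) ((2 * n + 3)%:R^-1 * (1 + 2 * n%:R * m + m ^+ 2)) (kernel_step mu).
Proof.
move=> K; have KK := kernel_conv K K; split.
- move=> _ /mapP[p pmu ->] /=; rewrite mulr_ge0 ?invr_ge0//.
  move: pmu; rewrite inE mem_cat => /orP[/eqP ->//|/orP[/flatten_mapP[k _]|/mapP[q qm ->]/=]].
    by rewrite mem_cat => /orP[] /mapP[q qm ->] /=; apply: kernel_ge0 K _ _.
  exact: kernel_ge0 KK _ _.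
- move=> _ /mapP[p pmu ->] /=.
  move: pmu; rewrite inE mem_cat => /orP[/eqP ->|/orP[/flatten_mapP[k _]|/mapP[q qm ->]/=]].
  + by rewrite !mxE !eqxx.
  + rewrite mem_cat => /orP[] /mapP[q qm ->] /=; rewrite !mxE eqxx (negbTE (neq_lift _ _));
    by rewrite (kernel_level K) ?add0r.
  + by rewrite !mxE !eqxx (kernel_level KK).
- move=> x; have n0 : 0 < (2 * n + 3)%:R :> R by rewrite ltr0n addn3.
  rewrite integ_step mulrC ler_pdivrMr// [leRHS]mulrC.
  have sub a c k nu : kernel c k nu -> integ nu (fun z => w (x + (a + z))) <= w (x + a).
    move=> K'; rewrite (@eq_integ _ _ (fun z => w (x + a + z))); last by move=> z;
      rewrite addrA.
    exact: kernel_submean K' _.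
  apply: le_trans (w_super x);
    rewrite (bigD1_ord j)//= [leLHS]addrC -[leLHS]addrA [leLHS]addrC.
  by apply: lerD; [rewrite lerD2r; apply: sub KK|apply: ler_sum => k _; apply: lerD;
    apply: sub K].
- move=> f; rewrite !integ_step reflect_offN reflect_off_axis; congr (_ * (_ + (_ + _))).
    apply: eq_bigr => k _; rewrite addrC; congr (_ + _).
      rewrite -(kernel_sym K (fun z => f ('e_(lift j k) + z))).
      by apply: eq_integ => z; rewrite reflect_offD reflect_offN reflect_off_lift opprK.
    rewrite -(kernel_sym K (fun z => f (- 'e_(lift j k) + z))).
    by apply: eq_integ => z; rewrite reflect_offD reflect_off_lift.
  rewrite -(kernel_sym KK (fun z => f ('e_j + z))).
  by apply: eq_integ => z; rewrite reflect_offD reflect_off_axis.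
- rewrite integ_step (kernel_mass K) (kernel_mass KK) sumr_const card_ord.
  by congr (_ * _); rewrite -mulr_natl; ring.
Qed.

End Kernels.

(** * Lower bound along a coordinate axis *)

Section AxisBound.
Variables (R : realType) (n : nat) (j : 'I_n.+1) (w : 'rV[int]_n.+1 -> R).
Local Notation lattice := 'rV[int]_n.+1.
Implicit Types (x y z a b : lattice) (mu nu : seq (R * lattice)).
Hypothesis w0 : forall x, 0 < w x.
Hypothesis w_super : forall x,
  \sum_(i < n.+1) (w (x + 'e_i) + w (x - 'e_i)) <= (2 * n + 3)%:R * w x.

Local Notation kernel := (kernel j w).
Local Notation moment2 := (moment2 j).
Local Notation coord := (coord R j).

Lemma moment2_step m mu k : kernel (-1) m mu ->
  moment2 k (kernel_step j mu) = (2 * n + 3)%:R^-1 *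
    (2 * n%:R * moment2 k mu + 2 * m + 2 * m * moment2 k mu).
Proof.
move=> K; have KK := kernel_conv K K.
have ej : coord k 'e_j = 0 by rewrite /coord mxE eq_sym (negbTE (neq_lift _ _)) andbF.
have ek k' : coord k 'e_(lift j k') = (k == k')%:R.
  by rewrite /coord mxE eqxx /= (inj_eq (@lift_inj _ j)); case: (k == k').
have coordN z : coord k (- z) = - coord k z by rewrite /coord mxE mulrNz.
rewrite /moment2 integ_step; congr (_ * _).
rewrite (moment2_translate 'e_j k KK) (moment2_conv k K K) coordN ej.
under eq_bigr => k' _ do
  rewrite (moment2_translate _ k K) (moment2_translate (- 'e_(lift j k')) k K) coordN ek sqrrN.
rewrite (_ : \sum_(_ < _) _ = 2 * n%:R * moment2 k mu + 2 * m);
  first by rewrite -/(moment2 k mu); ring.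
rewrite (bigD1 k)//= eqxx.
rewrite (eq_bigr (fun=> 2 * moment2 k mu)) => [|k' kk'].
  rewrite sumr_const cardC1 card_ord -[_ *+ n.-1]mulr_natl.
  have -> : n%:R = n.-1%:R + 1 :> R by case: (n) (k) => [[]//|n'] _; rewrite -natr1.
  by rewrite /= expr1n; move: (n.-1%:R : R) => l; ring.
by rewrite eq_sym (negbTE kk') expr0n /=; ring.
Qed.

(** The masses of the successive kernels, by [kernel_stepP]. *)
Definition mass (m : nat) : R :=
  iter m (fun t => (2 * n + 3)%:R^-1 * (1 + 2 * n%:R * t + t ^+ 2)) 0.

Let massS m : mass m.+1 = (2 * n + 3)%:R^-1 * (1 + 2 * n%:R * mass m + mass m ^+ 2).
Proof. by []. Qed.

Variable kappa : R.
Hypothesis kappa_gt0 : 0 < kappa.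
Hypothesis kappa_le : kappa <= 1 / 2.
Hypothesis kappaE : kappa ^+ 2 + 1 = 3 * kappa.

Let den_gt0 : 0 < (2 * n + 3)%:R :> R. Proof. by rewrite ltr0n addn3. Qed.

Let denE : (2 * n + 3)%:R = 2 * n%:R + 3 :> R. Proof. by rewrite natrD natrM. Qed.

Lemma mass_bounds m : 0 <= mass m <= kappa.
Proof.
elim: m => [|m /andP[m0 mk]]; first by rewrite lexx ltW.
have n0 := ler0n R n; have nm := mulr_ge0 n0 m0.
have nk : n%:R * mass m <= n%:R * kappa by rewrite ler_wpM2l.
rewrite massS mulrC; apply/andP; split.
  by rewrite divr_ge0 ?ltW//; have := sqr_ge0 (mass m); lra.
have m2 : mass m ^+ 2 <= kappa ^+ 2 by rewrite lerXn2r ?nnegrE// ltW.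
by rewrite ler_pdivrMr// denE; have := kappaE; lra.
Qed.

Lemma massS_ge m : (2 * n + 3)%:R^-1 <= mass m.+1.
Proof.
have /andP[m0 _] := mass_bounds m.
rewrite massS ler_peMr ?invr_ge0 ?(ltW den_gt0)//.
by have := sqr_ge0 (mass m); have := mulr_ge0 (ler0n R n) m0; lra.
Qed.

(** The mass recursion is [t -> (1 + 2 n t + t^2) / (2 n + 3)], for which [kappa]
    is a fixed point; below [kappa <= 1/2] it contracts by the factor
    [(2 n + 2 kappa) / (2 n + 3)]. *)
Lemma cvg_mass : mass m @[m --> \oo] --> kappa.
Proof.
pose rho : R := (2 * n + 1)%:R / (2 * n + 3)%:R.
have gap m : kappa - mass m <= rho ^+ m.
  elim: m => [|m IH]; first by rewrite subr0 expr0; move: kappa_le; lra.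
  have /andP[m0 mk] := mass_bounds m; have n0 := ler0n R n.
  rewrite massS (exprS rho).
  have -> : kappa - (2 * n + 3)%:R^-1 * (1 + 2 * n%:R * mass m + mass m ^+ 2) =
      (2 * n%:R + kappa + mass m) * (kappa - mass m) / (2 * n + 3)%:R.
    apply: (mulIf (lt0r_neq0 den_gt0));
      rewrite divfK ?lt0r_neq0// mulrBl mulrAC mulVf ?lt0r_neq0//.
    by rewrite denE; have := kappaE; lra.
  have k0 := kappa_gt0; have k1 := kappa_le; rewrite [leLHS]mulrAC; apply: ler_pM => //.
  - by rewrite divr_ge0 ?(ltW den_gt0)//; lra.
  - by lra.
  - by rewrite /rho ler_pM2r ?invr_gt0// natrD natrM; lra.
apply/cvgrPdist_le => e e0.
have rho1 : `|rho| < 1.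
  rewrite ger0_norm ?divr_ge0// ltr_pdivrMr// mul1r ltr_nat; lia.
have /cvgrPdist_le/(_ _ e0) := cvg_expr rho1; apply: filterS => m.
rewrite sub0r normrN => re; have /andP[_ mk] := mass_bounds m.
rewrite ger0_norm ?subr_ge0//; apply: le_trans (gap m) _.
by apply: le_trans re; exact: ler_norm.
Qed.

(** The part of the hitting distribution of [x_j = -1] that comes from paths whose
    decomposition into first steps has depth at most [m]. *)
Definition descent m : seq (R * lattice) := iter m (kernel_step j) [::].

Definition conv_pow mu N : seq (R * lattice) := iter N (conv mu) [:: (1, 0)].

(** The second moments [s] satisfy
    [s' = (2 n s + 2 m + 2 m s) / (2 n + 3)], where [m <= kappa <= 1/2] is the
    mass; hence the bound [s <= 1] is preserved. *)
Lemma descentP m : kernel (-1) (mass m) (descent m) /\ forall k, moment2 k (descent m) <= 1.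
Proof.
elim: m => [|m [K s1]].
  by split; [exact: kernel0|move=> k; rewrite /moment2 /integ big_nil].
split; first exact: (kernel_stepP w_super K).
move=> k; rewrite /= (moment2_step k K) mulrC ler_pdivrMr// mul1r denE.
have /andP[m0 mk] := mass_bounds m; have := s1 k; move: (moment2 _ _) => s s_le1.
have := ler_wpM2l (ler0n R n) s_le1; have := ler_wpM2l m0 s_le1.
by move: kappa_le; lra.
Qed.

(** The variance of a sum of [N] independent steps is [N] times the variance of one
    step; the factor [m] on the left avoids normalising the measure. *)
Lemma kernel_pow m mu N : kernel (-1) m mu -> (forall k, moment2 k mu <= 1) ->
  kernel (- N%:Z) (m ^+ N) (conv_pow mu N) /\
  forall k, m * moment2 k (conv_pow mu N) <= N%:R * m ^+ N.
Proof.
move=> K s1; elim: N => [|N [KN sN]].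
  split; first by rewrite expr0; exact: kernel1.
  by move=> k; rewrite /moment2 /integ big_seq1 /coord mxE expr0n !mulr0 mul0r.
split; first by rewrite intS opprD exprS; exact: kernel_conv K KN.
move=> k; rewrite /= (moment2_conv k K KN) exprS -natr1 mulrDl mul1r mulrDr addrC.
have m0 := kernel_mass_ge0 K.
apply: lerD; first by rewrite [leRHS]mulrCA ler_wpM2l.
by rewrite ler_wpM2l// ler_piMl// exprn_ge0.
Qed.

(** Two independent descents by [N] levels from [2 N e_j], the second one
    reflected, end at [0] exactly when their transverse displacements agree, so
    [w(2 N e_j)] is at least [w(0)] times the sum of the squared point masses.
    Chebyshev confines half of the mass [M] to a slab of size
    [S = (2 r + 1)^n], and Cauchy-Schwarz gives [(M / 2)^2 / S]. *)
Lemma kernel_return N r (M t : R) mu :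
  kernel (- N%:Z) M mu -> (forall k, moment2 k mu <= t) ->
  2 * n%:R * t <= r.+1%:R ^+ 2 * M ->
  w 0 * M ^+ 2 <= 4 * r.*2.+1%:R ^+ n * w ('e_j *+ N.*2).
Proof.
move=> K st tM.
pose B := undup (slab j (- N%:Z) r); pose a b := integ mu (fun z => (z == b)%:R).
pose S : R := r.*2.+1%:R ^+ n; have S0 : 0 < S by rewrite exprn_gt0.
have sizeB : (size B)%:R <= S by rewrite /S -natrX ler_nat -(size_slab j (- N%:Z)) size_undup.
have r0 : 0 < r.+1%:R ^+ 2 :> R by rewrite exprn_gt0.
have sumB z : \sum_(b <- B) (z == b)%:R = (z \in B)%:R :> R.
  have [zB|zB] := boolP (z \in B).
    rewrite (bigD1_seq z) ?undup_uniq//= eqxx big1 ?addr0// => b.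
    by rewrite eq_sym => /negbTE ->.
  rewrite big_seq big1// => b bB; case: eqP => // zb.
  by rewrite zb bB in zB.
have massB : M / 2 <= \sum_(b <- B) a b.
  have outside z : z 0 j = - N%:Z ->
      1 <= (z \in B)%:R + \sum_(k < n) r.+1%:R ^- 2 * coord k z ^+ 2.
    move=> zj; have [_|zB] := boolP (z \in B).
      by rewrite lerDl sumr_ge0// => k _; rewrite mulr_ge0 ?sqr_ge0 ?invr_ge0 ?(ltW r0).
    have [k zk] : exists k, (r < `|z 0%R (lift j k)|)%N.
      apply: contrapT => /forallNP zk; move: zB; rewrite mem_undup => /negP; apply.
      apply/mem_slab; split=> // k; rewrite eq_sym => /unlift_some[k' -> _].
      by rewrite leqNgt; apply/negP.
    rewrite add0r (bigD1 k)//= ler_wpDr//.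
      by rewrite sumr_ge0// => k' _; rewrite mulr_ge0 ?sqr_ge0 ?invr_ge0 ?(ltW r0).
    rewrite mulrC ler_pdivlMr// mul1r -[leRHS]real_normK ?num_real//.
    rewrite lerXn2r ?nnegrE// /coord -intr_norm.
    by rewrite -[r.+1%:R]/(r.+1%:Z%:~R) ler_int; move: zk; lia.
  have := le_integ K outside; rewrite (kernel_mass K) integD integ_sum.
  rewrite (@eq_integ _ _ _ _ (fun z => \sum_(b <- B) (z == b)%:R)); last first.
    by move=> z; rewrite sumB.
  rewrite integ_sum => Mle.
  have : \sum_(k < n) integ mu (fun z => r.+1%:R ^- 2 * coord k z ^+ 2) <= M / 2.
    apply: (@le_trans _ _ (\sum_(k < n) r.+1%:R ^- 2 * t)).
      by apply: ler_sum => k _; rewrite integZ ler_wpM2l ?invr_ge0 ?(ltW r0)//; exact: st.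
    rewrite sumr_const card_ord -[_ *+ n]mulr_natl mulrCA mulrC ler_pdivrMr//.
    by move: tM; lra.
  by move: Mle; rewrite -/(a _); lra.
(* Cauchy-Schwarz as a^2 >= 2 s a - s^2 summed over B, with s the optimal M / (2 S). *)
have energyB : M ^+ 2 / (4 * S) <= \sum_(b <- B) a b ^+ 2.
  pose s := M / (2 * S); have M0 := kernel_mass_ge0 K.
  have s0 : 0 <= s by rewrite divr_ge0// mulr_ge0// ltW.
  apply: (@le_trans _ _ (\sum_(b <- B) (2 * s * a b - s ^+ 2))); last first.
    by apply: ler_sum => b _; have := sqr_ge0 (a b - s); lra.
  rewrite big_split /= -mulr_sumr sumr_const_seq.
  have := ler_wpM2l (_ : 0 <= 2 * s) massB; rewrite mulr_ge0// => /(_ isT).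
  have := ler_wpM2r (sqr_ge0 s) sizeB.
  have -> : M ^+ 2 / (4 * S) = 2 * s * (M / 2) - S * s ^+ 2.
    by rewrite /s; field; rewrite gt_eqF.
  by lra.
have diag : \sum_(b <- B) a b ^+ 2 <= integ mu (fun z => integ mu (fun z' => (z == z')%:R)).
  apply: (@le_trans _ _ (integ mu (fun z => integ mu (fun z' =>
      \sum_(b <- B) (z == b)%:R * (z' == b)%:R)))).
    under [leRHS]eq_integ => z do rewrite integ_sum.
    rewrite integ_sum; apply: ler_sum => b _.
    under [leRHS]eq_integ => z do rewrite integZ mulrC.
    by rewrite integZ.
  apply: (le_integ K) => z _; apply: (le_integ K) => z' _.
  have [<-|zz'] := eqVneq z z'.
    under eq_bigr => b _ do rewrite -natrM mulnb andbb.
    by rewrite sumB lern1 leq_b1.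
  rewrite big1// => b _; case: eqP => [zb|_]; last by rewrite mul0r.
  by rewrite -zb eq_sym (negbTE zz') mulr0.
have ret : w 0 * integ mu (fun z => integ mu (fun z' => (z == z')%:R)) <= w ('e_j *+ N.*2).
  apply: le_trans (kernel_submean K _); rewrite -integZ; apply: (le_integ K) => z zj.
  apply: le_trans (kernel_submean K _); rewrite -integZ.
  rewrite -(kernel_sym K (fun z' => w (_ + z'))); apply: (le_integ K) => z' _.
  case: eqP => [<-|_]; last by rewrite mulr0 ltW.
  rewrite mulr1 le_eqVlt; apply/orP; left; apply/eqP; congr w.
  apply/rowP => i; rewrite !mxE mulmxnE mxE eqxx /=.
  by case: (eqVneq i j) => [->|_]; rewrite ?zj ?mul0rn ?add0r ?subrr// -mul2n; lia.
apply: (@le_trans _ _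
  (4 * S * (w 0 * integ mu (fun z => integ mu (fun z' => (z == z')%:R))))); last first.
  by rewrite ler_wpM2l// mulr_ge0// ltW.
rewrite [leRHS]mulrCA ler_wpM2l ?(ltW (w0 0))// [leRHS]mulrC -ler_pdivrMr ?mulr_gt0//.
exact: le_trans energyB diag.
Qed.

(** The condition on [r] is the one of [kernel_return] with the second moment
    [N mass^(N-1)], using only [mass >= 1 / (2 n + 3)], so that [r] does not depend
    on the kernel and [mass] can tend to [kappa]. *)
Lemma even_axis_lower_bound N r : (2 * n * (2 * n + 3) * N <= r.+1 ^ 2)%N ->
  w 0 * kappa ^+ N.*2 <= 4 * r.*2.+1%:R ^+ n * w ('e_j *+ N.*2).
Proof.
move=> rN.
have bound m : w 0 * mass m.+1 ^+ N.*2 <= 4 * r.*2.+1%:R ^+ n * w ('e_j *+ N.*2).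
  have [K s1] := descentP m.+1; have m0 : 0 < mass m.+1.
    by apply: lt_le_trans (massS_ge m); rewrite invr_gt0.
  have [KN sN] := kernel_pow N K s1.
  rewrite [mass _ ^+ _](_ : _ = (mass m.+1 ^+ N) ^+ 2); last by rewrite -exprM muln2.
  apply: (kernel_return KN (t := N%:R * mass m.+1 ^+ N / mass m.+1)).
    by move=> k; rewrite ler_pdivlMr// mulrC.
  have MN0 : 0 <= mass m.+1 ^+ N by rewrite exprn_ge0// ltW.
  apply: (@le_trans _ _ (2 * n%:R * (N%:R * mass m.+1 ^+ N * (2 * n + 3)%:R))).
    rewrite ler_wpM2l ?mulr_ge0// ler_wpM2l ?mulr_ge0//.
    by rewrite -[leRHS]invrK lef_pV2 ?posrE ?invr_gt0//; exact: massS_ge.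
  rewrite [leLHS](_ : _ = (2 * n * (2 * n + 3) * N)%:R * mass m.+1 ^+ N).
    by rewrite ler_wpM2r// -natrX ler_nat.
  by rewrite !natrM; ring.
have cvgm : w 0 * mass m ^+ N.*2 @[m --> \oo] --> w 0 * kappa ^+ N.*2.
  apply: cvgMr => //; elim: (N.*2) => [|l IH]; first by under eq_fun do rewrite expr0;
    exact: cvg_cst.
  under eq_fun do rewrite exprS; rewrite exprS; exact: cvgM cvg_mass IH.
rewrite -(cvg_lim _ cvgm)//; apply: limr_le; first by apply: cvgP cvgm.
by exists 1%N => // -[//|m] _; apply: bound.
Qed.

End AxisBound.

Section AllAxisPoints.
Variables (R : realType) (n : nat).
Local Notation lattice := 'rV[int]_n.+1.

(** For [M = 2 N] or [2 N + 1] take [r] of order [sqrt N] in the previous lemma; an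
    odd [M] costs one application of [w(x - e_j) <= (2 n + 3) w(x)].  The range
    starts at [M = 2] because [r] is compared with [sqrt N] for [N >= 1]. *)
Lemma axis_lower_bound (j : 'I_n.+1) (w : lattice -> R) (kappa : R) :
  (forall x, 0 < w x) ->
  (forall x, \sum_(i < n.+1) (w (x + 'e_i) + w (x - 'e_i)) <= (2 * n + 3)%:R * w x) ->
  0 < kappa -> kappa <= 1 / 2 -> kappa ^+ 2 + 1 = 3 * kappa ->
  exists2 c : R, 0 < c & forall M, (2 <= M)%N ->
    c * kappa ^+ M <= w ('e_j *+ M) * Num.sqrt M%:R ^+ n.
Proof.
move=> w0 w_super k0 k1 kE.
pose D : R := (2 * n + 3)%:R; pose A : R := 4 * D.
have D1 : 1 <= D by rewrite ler1n; lia.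
have D0 : 0 < D by apply: lt_le_trans D1.
have A0 : 0 < A by rewrite mulr_gt0.
have harnack x : w (x - 'e_j) <= D * w x.
  apply: le_trans (w_super x); rewrite (bigD1 j)//= -addrA addrCA lerDl.
  apply: addr_ge0; first exact: ltW.
  by apply: sumr_ge0 => i _; rewrite addr_ge0// ltW.
have q0 : 0 < 4 * A ^+ n * D by rewrite !mulr_gt0 ?exprn_gt0.
exists (w 0 / (4 * A ^+ n * D)) => [|M M2]; first by rewrite divr_gt0.
rewrite mulrAC ler_pdivrMr//.
pose N := M./2; have N1 : (1 <= N)%N by rewrite /N; lia.
have ME : M = (odd M + N.*2)%N by rewrite odd_double_half.
have [t [t1 tN Nt]] : exists t, [/\ (1 <= t)%N, (t ^ 2 <= N)%N & (N <= t.+1 ^ 2)%N].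
  have [] := PeanoNat.Nat.sqrt_spec N (le_0_n N).
  by exists (Nat.sqrt N); split; nia.
(* (r + 1)^2 >= (2 n + 3)^2 N since t + 1 >= sqrt N. *)
pose r := ((2 * n + 3) * t.+1).-1.
have rS : r.+1 = ((2 * n + 3) * t.+1)%N by rewrite /r prednK// muln_gt0 addn3.
have rN : (2 * n * (2 * n + 3) * N <= r.+1 ^ 2)%N.
  rewrite rS expnMn leq_mul// mulnC -mulnn leq_mul//; lia.
have sqrtN : t%:R <= Num.sqrt M%:R :> R.
  rewrite -[leLHS]ger0_norm// -sqrtr_sqr ler_wsqrtr// -natrX ler_nat; lia.
have rA : r.*2.+1%:R <= A * Num.sqrt M%:R.
  apply: (@le_trans _ _ (A * t%:R)); last by rewrite ler_wpM2l// ltW.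
  by rewrite /A /D -!natrM ler_nat; nia.
have step : w ('e_j *+ N.*2) <= D * w ('e_j *+ M).
  rewrite ME; case: (odd M); last by rewrite add0n ler_peMl// ltW.
  by apply: le_trans (harnack _); rewrite add1n mulrSr addrK.
apply: (@le_trans _ _ (w 0 * kappa ^+ N.*2)).
  rewrite ler_wpM2l ?(ltW (w0 0))// ME exprD ler_piMl ?exprn_ge0 ?(ltW k0)//.
  by rewrite exprn_ile1 ?(ltW k0)//; lra.
apply: le_trans (even_axis_lower_bound j w0 w_super k0 k1 kE rN) _.
have wM := w0 ('e_j *+ M); have s0 := sqrtr_ge0 (M%:R : R).
rewrite [leRHS](_ : _ = 4 * (A * Num.sqrt M%:R) ^+ n * (D * w ('e_j *+ M))); last first.
  by rewrite (exprMn _ A); ring.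
apply: ler_pM => //; rewrite ?mulr_ge0 ?exprn_ge0 ?(ltW (w0 _))//.
by rewrite ler_wpM2l// lerXn2r ?nnegrE ?mulr_ge0// ltW.
Qed.

End AllAxisPoints.

(** * Consequences of the bounds at infinity *)

Section Asymptotics.
Variables (R : realType) (n : nat).
Local Notation lattice := 'rV[int]_n.+1.
Implicit Types (x y z : lattice).

Lemma supn_le_enorm x : (supn x)%:R <= enorm R x.
Proof.
have [i ->] := supn_attained x; rewrite /enorm.
have -> : `|x 0%R i|%N%:R = `|(x 0 i)%:~R| :> R by rewrite natr_absz intr_norm.
rewrite -sqrtr_sqr ler_wsqrtr// (bigD1 i)//= lerDl.
by apply: sumr_ge0 => k _; apply: sqr_ge0.
Qed.

Lemma bounded_cofinite (T : choiceType) (f : T -> R) (A : set T) (K : R) :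
  (forall a, 0 <= f a) -> finite_set (~` A) -> (forall a, A a -> f a <= K) ->
  exists C, forall a, f a <= C.
Proof.
move=> f0 /finite_seqP[s As] fK; exists (`|K| + \sum_(a <- s) f a) => a.
have s0 : 0 <= \sum_(b <- s) f b by apply: sumr_ge0.
have [aA|aA] := pselect (A a).
  by rewrite (le_trans (fK a aA))// (le_trans (ler_norm K))// lerDl.
have as_ : a \in s by have : [set` s] a by rewrite -As.
by rewrite ler_wpDl// (big_rem a)//= lerDl sumr_ge0.
Qed.

(** Here the exponent [2 - d = - (m + 1)] is negative, so replacing the Euclidean norm
    by the smaller sup norm weakens the bound.  The finitely many exceptional points
    of the cofinite filter, and the origin, only affect the constant. *)
Lemma inO_growth m (u : lattice -> R) : n = m.+2 ->
  inO u (fun x => enorm R x `^ ((2 - n.+1%:R) / 2)) ->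
  exists C, forall x, u x ^+ 2 * (supn x).+1%:R ^+ m.+1 <= C.
Proof.
move=> nE /ereal_inf_lt[y [A Afin <-{y}]] supA.
have [K AK] : exists K : R, forall x, A x ->
    `|u x| / `|enorm R x `^ ((2 - n.+1%:R) / 2)| <= K.
  have ubA x : A x -> ((`|u x| / `|enorm R x `^ ((2 - n.+1%:R) / 2)|)%:E <=
      ereal_sup [set (`|u x| / `|enorm R x `^ ((2 - n.+1%:R) / 2)|)%:E | x in A])%E.
    by move=> Ax; apply: ereal_sup_ubound; exists x.
  case: (ereal_sup _) supA ubA => [K|//|] _ ubA; [exists K|exists 0] => x /ubA.
    by rewrite lee_fin.
  by rewrite leeNy_eq.
apply: (@bounded_cofinite _ _ (A `\ 0) (2 ^+ m.+1 * K ^+ 2)).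
- by move=> x; rewrite mulr_ge0 ?sqr_ge0 ?exprn_ge0.
- rewrite setDE setCI setCK finite_setU; split=> //.
move=> x [Ax /= x0].
have s1 : (0 < supn x)%N.
  rewrite lt0n; apply: contra_notN x0 => /eqP s0; apply/rowP => i.
  by have := leq_supn x i; rewrite s0 mxE; move: (x 0 i) => a; lia.
have e0 : 0 < enorm R x by apply: lt_le_trans (supn_le_enorm x); rewrite ltr0n.
have := AK x Ax; rewrite (gtr0_norm (powR_gt0 _ e0)) ler_pdivrMr ?powR_gt0// => ux.
have u2 : u x ^+ 2 <= K ^+ 2 / enorm R x ^+ m.+1.
  rewrite -[leLHS]real_normK ?num_real//.
  apply: (@le_trans _ _ ((K * enorm R x `^ ((2 - n.+1%:R) / 2)) ^+ 2)).
    by rewrite lerXn2r ?nnegrE//; apply: le_trans ux.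
  rewrite exprMn -[(_ `^ _) ^+ 2]powR_mulrn ?powR_ge0// -powRrM.
  rewrite (_ : (2 - n.+1%:R) / 2 * 2 = - m.+1%:R); last first.
    by rewrite nE divfK// -!natr1; ring.
  by rewrite powRN powR_mulrn// ltW.
have s2 : (supn x).+1%:R ^+ m.+1 <= 2 ^+ m.+1 * enorm R x ^+ m.+1.
  rewrite -exprMn lerXn2r ?nnegrE ?mulr_ge0 ?(ltW e0)//.
  apply: (@le_trans _ _ (2 * (supn x)%:R)); first by rewrite -natrM ler_nat; lia.
  by rewrite ler_wpM2l// supn_le_enorm.
apply: le_trans (ler_pM (sqr_ge0 _) _ u2 s2) _; first by rewrite exprn_ge0.
rewrite le_eqVlt; apply/orP; left; apply/eqP; field.
by rewrite gt_eqF// exprn_gt0.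
Qed.

(** Both growth hypotheses amount to [u^2 = O(r^(2-d))] in the sup norm, written
    without negative exponents; for [d = 1, 2] the function [r^(2-d)] is bounded
    below, so boundedness suffices. *)
Lemma growth_bound (u : lattice -> R) :
  ((n.+1 <= 2)%N -> bounded_fun u) ->
  ((3 <= n.+1)%N -> inO u (fun x => enorm R x `^ ((2 - n.+1%:R) / 2))) ->
  exists C, forall x, u x ^+ 2 * (supn x).+1%:R ^+ n.+1 <= C * (supn x).+1%:R ^+ 2.
Proof.
move=> ubnd uO; have [n2|n3] := leqP n.+1 2.
  have [M [_ uM]] := ubnd n2; exists ((M + 1) ^+ 2) => x.
  have := uM (M + 1) (ltr_pwDr ltr01 (lexx M)) x I => ux.
  apply: ler_pM; rewrite ?sqr_ge0 ?exprn_ge0//.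
    rewrite -[leLHS]real_normK ?num_real// lerXn2r ?nnegrE//.
    exact: le_trans ux.
  by rewrite ler_weXn2l// ler1n.
have [m nE] : exists m, n = m.+2 by exists n.-2; lia.
have [C uC] := inO_growth nE (uO n3); exists C => x.
have := uC x; move: ((supn x).+1%:R : R) (ler0n R (supn x).+1) => q q0 uq.
by rewrite nE -(addn2 m.+1) exprD mulrA ler_wpM2r ?exprn_ge0.
Qed.

Lemma limn_einf_ge (s : nat -> R) (c : R) (N : nat) :
  (forall k, (N <= k)%N -> c <= s k) -> (c%:E <= limn_einf (fun k => (s k)%:E))%E.
Proof.
move=> sc; rewrite /limn_einf leeNr; apply: ereal_inf_le.
exists (ereal_sup [set - (s k)%:E | k in [set k | (N <= k)%N]])%E.
  exists [set k | (N <= k)%N] => //; exact: nbhs_infty_ge.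
by apply: ub_ereal_sup => _ [k Nk <-]; rewrite leeN2 lee_fin sc.
Qed.

End Asymptotics.

Theorem theorem4p2 (R : realType) (d : nat) (V u : 'rV[int]_d -> R) :
  (1 <= d)%N ->
  (forall x, V x <= 1) ->
  positive_schroedinger V ->
  H_harmonic V u ->
  ((d <= 2)%N -> bounded_fun u) ->
  ((3 <= d)%N -> inO u (fun x => enorm R x `^ ((2 - d%:R) / 2))) ->
  (exists j : 'I_d,
     limn_einf (fun n => (`|u (delta_mx 0 j *+ n)| * n%:R `^ ((d%:R - 1) / 2)
                          * expR (arcosh (3 / 2) * n%:R))%:E) = 0%E) ->
  forall x, u x = 0.
Proof.
case: d V u => // n V u _ V1 [w [wx w_ge0 Hw]] Hu ubnd uO [j liminf0].
have w0 := supersolution_gt0 wx w_ge0 Hw.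
have w_super x : \sum_(i < n.+1) (w (x + 'e_i) + w (x - 'e_i)) <= (2 * n + 3)%:R * w x.
  have := Hw x; rewrite /schroedinger laplacianE.
  rewrite (eq_bigr (fun i => 2 * w x - (w (x + 'e_i) + w (x - 'e_i)))); last first.
    by move=> i _; ring.
  rewrite sumrB sumr_const card_ord -[_ *+ n.+1]mulr_natl => H.
  have := ler_wpM2r (w_ge0 x) (V1 x); rewrite mul1r natrD natrM.
  by move: H; rewrite -natr1; lra.
have [C uC] := growth_bound ubnd uO.
have [c uE] := liouville Hu w0 Hw uC.
have [c0 x|c0] := eqVneq c 0; first by rewrite uE c0 mul0r.
have [lambda0 coshE] : 0 <= arcosh (3 / 2) :> R /\ cosh (arcosh (3 / 2)) = 3 / 2 :> R.
  by apply: arcoshK; lra.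
move: (arcosh _) lambda0 coshE liminf0 => lambda lambda0 coshE liminf0.
pose kappa := expR (- lambda); have k0 : 0 < kappa := expR_gt0 _.
have k1 : kappa <= 1 by rewrite /kappa -expR0 ler_expR; lra.
have kE : kappa ^+ 2 + 1 = 3 * kappa.
  have kl : kappa * expR lambda = 1 by rewrite /kappa -expRD addNr expR0.
  have : expR lambda + kappa = 3 by move: coshE; rewrite /cosh -/kappa; lra.
  move=> /(congr1 (fun t => kappa * t)); rewrite mulrDr kl; lra.
have k2 : kappa <= 1 / 2 by nra.
have [b b0 wb] := axis_lower_bound j w0 w_super k0 k2 kE.
have cb : 0 < `|c| * b by rewrite mulr_gt0 ?normr_gt0.
suff : ((`|c| * b)%:E <= 0 :> \bar R)%E by rewrite lee_fin leNgt cb.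
rewrite -liminf0; apply: (@limn_einf_ge _ _ _ 2) => M M2.
rewrite uE normrM (gtr0_norm (w0 _)) expRM_natr.
have -> : M%:R `^ ((n.+1%:R - 1) / 2) = Num.sqrt M%:R ^+ n :> R.
  by rewrite -natr1 addrK mulrC powRrM powR12_sqrt// powR_mulrn// sqrtr_ge0.
rewrite -!mulrA ler_wpM2l// mulrA.
have -> : expR lambda ^+ M = (kappa ^+ M)^-1 by rewrite /kappa expRN exprVn invrK.
by rewrite ler_pdivlMr ?exprn_gt0// wb.
Qed.
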